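(* Let $f:\mathbb{R}\to\mathbb{R}$ be continuous with $l_f^\infty=\emptyset$. Then $L_f^\infty$ is a trim $G_\delta$ subset of $\mathbb{R}$. Conversely, if $E\subset\mathbb{R}$ is a trim $G_\delta$ set, then there exists a continuous function $f:\mathbb{R}\to\mathbb{R}$ such that $L_f^\infty=E$ and $l_f^\infty=\emptyset$; moreover, $f$ can be chosen so that in addition $\operatorname{lip} f(x)=0$ for all $x\in E$.
   Context: For a continuous $f:\mathbb{R}\to\mathbb{R}$, $x\in\mathbb{R}$ and $r>0$, let $M_f(x,r)=\sup\{|f(x)-f(y)|/r : |x-y|\le r\}$. Define $\operatorname{Lip} f(x)=\limsup_{r\to0^+}M_f(x,r)$ and $\operatorname{lip} f(x)=\liminf_{r\to0^+}M_f(x,r)$ (values in $[0,\infty]$). Let $L_f^\infty=\{x\in\mathbb{R}:\operatorname{Lip} f(x)=\infty\}$ and $l_f^\infty=\{x\in\mathbb{R}:\operatorname{lip} f(x)=\infty\}$. A set $E\subset\mathbb{R}$ is called trim if $|E\cap(a,b)|<b-a$ for every open interval $(a,b)$ with $a<b$, where $|\cdot|$ denotes Lebesgue (outer) measure. *)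

(* Defs.v *)
From HB Require Import structures.
From mathcomp Require Import all_boot all_order all_algebra.
From mathcomp Require Import all_classical all_reals all_analysis borel_hierarchy.
Set Implicit Arguments. Unset Strict Implicit. Unset Printing Implicit Defensive.
Import Order.TTheory GRing.Theory Num.Theory.
Import numFieldNormedType.Exports.
Local Open Scope classical_set_scope.
Local Open Scope ring_scope.

Definition Mf (R : realType) (f : R -> R) (x r : R) : \bar R :=
  ereal_sup [set ((`|f x - f y| / r)%:E) | y in [set y | `|x - y| <= r]].

Definition Lip (R : realType) (f : R -> R) (x : R) : \bar R :=
  limf_esup (Mf f x) (0^'+).

Definition lip (R : realType) (f : R -> R) (x : R) : \bar R :=
  limf_einf (Mf f x) (0^'+).

Definition L_inf (R : realType) (f : R -> R) : set R :=
  [set x | Lip f x = +oo%E].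
Definition l_inf (R : realType) (f : R -> R) : set R :=
  [set x | lip f x = +oo%E].

Definition lebesgue_outer (R : realType) (A : set R) : \bar R :=
  ((@wlength R idfun)^* A)%mu.

Definition trim (R : realType) (E : set R) : Prop :=
  forall a b : R, a < b ->
    (lebesgue_outer (E `&` `]a, b[%classic) < (b - a)%:E)%E.

(* Main.v *)
Require Import Defs.
From HB Require Import structures.
From mathcomp Require Import all_boot all_order all_algebra.
From mathcomp Require Import all_classical all_reals all_analysis borel_hierarchy.
From mathcomp Require Import ring lra.
Import Order.TTheory GRing.Theory Num.Theory.
Import numFieldNormedType.Exports.
Local Open Scope classical_set_scope.
Local Open Scope ring_scope.

(* Direct part. [Lip f x] is infinite iff arbitrarily short chords from [x] are
   arbitrarily steep, which is a Gdelta condition.  If it held almost everywhere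
   in an interval, then inside any chord of slope [N] one would find a much
   shorter and steeper chord such that all scales in between are still steep at
   every point of the short one; nesting such chords gives a point where
   [lip f] is infinite.

   Converse. Exhaust the complement of [E] by increasing closed sets [Q n]; [f] is
   a sum of layers [g n], each locally constant off [Q n.+1] and bounded by
   [2^-(n+1) * dist(-, Q n)].  A layer consists of Cantor-type bumps, supported
   by closed sets of positive measure that miss [E] (trimness provides them), one
   on each tile of a Whitney decomposition of the complement of [Q n], and much
   higher than the tile is wide.  At a point of [E], layers [0..n-1] are constant
   up to the distance to [Q n] and the later ones are negligible at that scale,
   while layer [n] has a steep chord. *)

(** * Chord conditions for [Lip] and [lip] *)

Lemma Mf_le (R : realType) (f : R -> R) (x r N : R) : 0 < r ->
  (forall y, `|x - y| <= r -> `|f x - f y| <= N * r) ->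
  (Mf f x r <= N%:E)%E.
Proof.
move=> r0 H; apply: ge_ereal_sup => _ [y /= xy <-].
by rewrite lee_fin ler_pdivrMr // H.
Qed.

Lemma Mf_ge (R : realType) (f : R -> R) (x r N y : R) : 0 < r ->
  `|x - y| <= r -> N * r <= `|f x - f y| -> (N%:E <= Mf f x r)%E.
Proof.
move=> r0 xy H; apply: le_ereal_sup_tmp; exists (`|f x - f y| / r)%:E; first by exists y.
by rewrite lee_fin ler_pdivlMr.
Qed.

Lemma nbhs_right0_ltP (R : realType) (V : set R) :
  (0^'+)%classic V <-> exists2 d : R, 0 < d & forall r, 0 < r < d -> V r.
Proof.
split=> [[d /= d0 H]|[d d0 H]].
  exists d => // r /andP[r0 rd]; apply: H => //=.
  by rewrite sub0r normrN gtr0_norm.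
exists d => //= r; rewrite /= sub0r normrN => rd r0.
by apply: H; rewrite r0 -(gtr0_norm r0).
Qed.

(** If every chord from [x] shorter than [d] has slope below [N], then [Mf f x] is at most
    [Num.max N 0] on []0, d[]; the maximum guards against a negative [N]. Conversely, a steep chord
    from [x] makes [Mf f x] large at the radius equal to its length. *)
Lemma Lip_ooP (R : realType) (f : R -> R) (x : R) : Lip f x = +oo%E <->
  forall N d : R, 0 < d ->
    exists2 y, 0 < `|x - y| < d & N * `|x - y| <= `|f x - f y|.
Proof.
split=> [L N d d0|H].
  apply: contrapT => nH.
  suff : (Lip f x <= (Num.max N 0)%:E)%E by rewrite L leye_eq.
  rewrite /Lip limf_esupE; apply: ge_ereal_inf.
  exists (ereal_sup (Mf f x @` [set r | 0 < r < d])).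
    by exists [set r | 0 < r < d] => //; apply/nbhs_right0_ltP; exists d.
  apply: ge_ereal_sup => _ [r /= /andP[r0 rd] <-]; apply: Mf_le => // y xy.
  have [->|xNy] := eqVneq x y.
    by rewrite !subrr normr0 mulr_ge0 // ?le_max ?lexx ?orbT // ltW.
  have xy0 : 0 < `|x - y| by rewrite normr_gt0 subr_eq0.
  have /ltW : `|f x - f y| < N * `|x - y|.
    rewrite ltNge; apply/negP => Hy; apply: nH; exists y => //.
    by rewrite xy0 (le_lt_trans xy).
  move/le_trans; apply.
  apply: (@le_trans _ _ (Num.max N 0 * `|x - y|)).
    by rewrite ler_wpM2r // le_max lexx.
  by rewrite ler_wpM2l // le_max lexx orbT.
apply/eqP; rewrite -leye_eq /Lip limf_esupE.
apply: le_ereal_inf_tmp => _ [V /nbhs_right0_ltP[d d0 Vd] <-].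
suff -> : ereal_sup (Mf f x @` V) = +oo%E by [].
apply: eq_infty => N; have [y xy HN] := H N _ d0.
apply: le_ereal_sup_tmp; exists (Mf f x `|x - y|); first by exists `|x - y| => //; exact: Vd.
by have /andP[xy0 _] := xy; exact: (Mf_ge _ _ _ _ _ y).
Qed.

Lemma Lip_lt_oo (R : realType) (f : R -> R) (x C d : R) : 0 < d ->
  (forall y, `|x - y| < d -> `|f x - f y| <= C * `|x - y|) -> Lip f x <> +oo%E.
Proof.
move=> d0 H /Lip_ooP /(_ (C + 1) _ d0)[y /andP[xy0 xyd]].
by apply/negP; rewrite -ltNge (le_lt_trans (H _ xyd)) // ltr_pM2r // ltrDl.
Qed.

Lemma lip_le (R : realType) (f : R -> R) (x N : R) :
  (forall d, 0 < d -> exists2 r, 0 < r < d &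
     forall y, `|x - y| <= r -> `|f x - f y| <= N * r) ->
  (lip f x <= N%:E)%E.
Proof.
move=> H; rewrite /lip limf_einfE; apply: ge_ereal_sup => _ [V /nbhs_right0_ltP[d d0 Vd] <-].
have [r rd Hr] := H _ d0; apply: ge_ereal_inf.
exists (Mf f x r); first by exists r => //; exact: Vd.
by apply: Mf_le => //; case/andP: rd.
Qed.

Lemma lip_ge0 (R : realType) (f : R -> R) (x : R) : (0 <= lip f x)%E.
Proof.
rewrite /lip limf_einfE; apply: le_ereal_sup_tmp.
exists (ereal_inf (Mf f x @` [set r | 0 < r])).
  by exists [set r | 0 < r] => //; apply/nbhs_right0_ltP; exists 1 => // r /andP[].
apply: le_ereal_inf_tmp => _ [r /= r0 <-].
by apply: (Mf_ge _ _ _ _ _ x); rewrite // ?subrr ?normr0 ?mul0r // ltW.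
Qed.

Lemma lip_oo (R : realType) (f : R -> R) (x : R) :
  (forall N : R, exists2 d : R, 0 < d & forall r, 0 < r < d ->
    exists2 y, `|x - y| <= r & N * r <= `|f x - f y|) -> lip f x = +oo%E.
Proof.
move=> H; apply: eq_infty => N; have [d d0 Hd] := H N.
rewrite /lip limf_einfE; apply: le_ereal_sup_tmp.
exists (ereal_inf (Mf f x @` [set r | 0 < r < d])).
  by exists [set r | 0 < r < d] => //; apply/nbhs_right0_ltP; exists d.
apply: le_ereal_inf_tmp => _ [r /= rd <-]; have [y xy Hy] := Hd _ rd.
by case/andP: rd => r0 _; exact: (Mf_ge _ _ _ _ _ y).
Qed.

(** The supremum of the points of [[a, b]] satisfying [P] satisfies [P] too, by the closure
    hypothesis, and the progress hypothesis would push past it unless it is [b]. *)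
Lemma real_induction (R : realType) (a b : R) (P : R -> Prop) : a <= b -> P a ->
  (forall t, a < t <= b ->
     (forall e, 0 < e -> exists2 s, t - e < s <= t & a <= s /\ P s) -> P t) ->
  (forall t, a <= t < b -> P t -> exists2 s, t < s <= b & P s) ->
  P b.
Proof.
move=> ab Pa Pcl Pstep.
pose S := [set t | a <= t <= b /\ P t].
have Sa : S a by rewrite /S /= lexx ab.
have Sub : has_sup S by split; [exists a | exists b => t [/andP[]]].
have aS : a <= sup S by apply: ub_le_sup Sa; case: Sub.
have Sb : sup S <= b by apply: ge_sup; [exists a | move=> t [/andP[]]].
have PS : P (sup S).
  move: aS; rewrite le_eqVlt => /orP[/eqP<- //|aS].
  apply: Pcl => [|e e0]; first by rewrite aS Sb.
  have [t [/andP[at_ tb] Pt] Ht] := sup_adherent e0 Sub.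
  exists t => //; rewrite Ht /=; apply: ub_le_sup => //; first by case: Sub.
  by split=> //; rewrite at_ tb.
move: (Sb); rewrite le_eqVlt => /orP[/eqP<- //|Sltb].
have [|s /andP[Ss sb] Ps] := Pstep _ _ PS; first by rewrite aS Sltb.
have : s <= sup S.
  apply: ub_le_sup; first by case: Sub.
  by split=> //; rewrite sb (le_trans aS) // ltW.
by rewrite leNgt Ss.
Qed.

(** * [L_inf f] is a Gdelta set *)

Lemma Gdelta_L_inf (R : realType) (f : R -> R) : continuous f -> Gdelta (L_inf f).
Proof.
move=> cf.
(* For a fixed far end [y], the conditions are strict inequalities between continuous functions of
   [x], so each [V n] is open. *)
pose V n := \bigcup_y ([set x | 0 < `|x - y|] `&` [set x | `|x - y| < n.+1%:R^-1]
  `&` [set x | n%:R * `|x - y| < `|f x - f y|]).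
have cd (y : R) : continuous (fun x : R => `|x - y|).
  move=> x; apply: cvg_norm; apply: cvgB; [exact: cvg_id | exact: cvg_cst].
exists V => [n|].
  apply: bigcup_open => y _; apply: openI; first apply: openI.
  - exact: (@open_comp _ _ (fun x : R => `|x - y|) [set z | 0 < z]) => // x _; exact: cd.
  - by apply: (@open_comp _ _ (fun x : R => `|x - y|) [set z | z < n.+1%:R^-1]) => // x _; exact: cd.
  - have -> : [set x | n%:R * `|x - y| < `|f x - f y|] =
              (fun x => `|f x - f y| - n%:R * `|x - y|) @^-1` [set z | 0 < z].
      by apply/seteqP; split=> x /=; rewrite subr_gt0.
    apply: open_comp => // x _; apply: cvgB; last first.
      apply: cvgM; [exact: cvg_cst | exact: cd].
    by apply: cvg_norm; apply: cvgB; [exact: cf | exact: cvg_cst].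
apply/seteqP; split=> x.
  move=> /Lip_ooP H n _.
  (* Slope [n+1] turns the weak inequality of [Lip_ooP] into the strict one in [V n]. *)
  have [|y /andP[y0 yn] Hy] := H n.+1%:R n.+1%:R^-1; first by rewrite invr_gt0.
  exists y => //; split => //=; apply: lt_le_trans Hy.
  by rewrite ltr_pM2r // ltr_nat.
move=> H; apply/Lip_ooP => N d d0.
pose n := maxn (Num.trunc `|N|).+1 (Num.trunc d^-1).+1.
have [y _ [[/= y0 yn] Hy]] := H n I.
exists y.
  rewrite y0 (lt_le_trans yn) //.
  rewrite -[leRHS]invrK lef_pV2 ?posrE ?invr_gt0 //.
  apply/ltW/(lt_le_trans (Num.Theory.truncnS_gt d^-1)).
  by rewrite ler_nat; apply: leq_trans (leq_maxr _ _) (leqnSn _).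
apply/ltW/(le_lt_trans _ Hy); rewrite ler_pM2r //.
apply: (le_trans (ler_norm _)); apply/ltW/(lt_le_trans (Num.Theory.truncnS_gt `|N|)).
by rewrite ler_nat leq_maxl.
Qed.

(** * Distribution function of Lebesgue measure on a set *)

Definition cumul (R : realType) (K : set R) (a t : R) : R :=
  fine (lebesgue_measure (K `&` `]a, t])).

Section Cumul.
Variables (R : realType) (K : set R) (a : R).
Hypothesis mK : measurable K.

Lemma measurable_cut (u v : R) : measurable (K `&` `]u, v] : set (measurableTypeR R)).
Proof. exact: measurableI. Qed.

Lemma cut_le (u v : R) : u <= v ->
  (lebesgue_measure (K `&` `]u, v]) <= (v - u)%:E)%E.
Proof.
move=> uv; apply: (@le_trans _ _ (lebesgue_measure (`]u, v]%classic : set R))).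
  by apply: le_measure; rewrite ?inE //; exact: measurable_cut.
rewrite lebesgue_measure_itv /= lte_fin; case: ifPn => // _.
by rewrite lee_fin subr_ge0.
Qed.

Lemma cut_fin (u v : R) : lebesgue_measure (K `&` `]u, v]) \is a fin_num.
Proof.
have [vu|uv] := ltP v u.
  rewrite (_ : _ `&` _ = set0) ?measure0 //.
  rewrite set_itv_ge ?setI0 //= bnd_simp -leNgt; exact: ltW.
rewrite ge0_fin_numE //; exact: le_lt_trans (cut_le _ _ uv) (ltry _).
Qed.

Lemma cumulD (t s : R) : a <= t <= s -> cumul R K a s = cumul R K a t + cumul R K t s.
Proof.
move=> /andP[at_ ts]; rewrite /cumul -fineD ?cut_fin // -measureU //; last 3 first.
- exact: measurable_cut.
- exact: measurable_cut.
- apply/seteqP; split=> x //= -[[_ +] [_ +]]; rewrite !in_itv /= => /andP[_ xt] /andP[tx _].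
  by move: (lt_le_trans tx xt); rewrite ltxx.
rewrite -setIUr; congr (fine (lebesgue_measure (_ `&` _))).
apply/seteqP; split=> x /=; rewrite !in_itv /=.
  by move=> /andP[ax xs]; have [xt|tx] := leP x t; [left|right]; rewrite ?ax ?xt ?tx ?xs.
by case=> /andP[p q]; rewrite ?(le_trans q) ?p ?q ?(le_lt_trans at_ p).
Qed.

Lemma cumul_ge0 (t s : R) : 0 <= cumul R K t s.
Proof. by rewrite fine_ge0. Qed.

Lemma cumul_le (t s : R) : t <= s -> cumul R K t s <= s - t.
Proof. by move=> ts; rewrite -lee_fin fineK ?cut_fin // cut_le. Qed.

Lemma cumul_full (t s : R) : t <= s -> `]t, s] `<=` K -> cumul R K t s = s - t.
Proof.
move=> ts sK; rewrite /cumul setIidr // lebesgue_measure_itv /= lte_fin.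
by case: ltgtP ts => // -> _; rewrite subrr.
Qed.

Lemma cumul_empty (t s : R) : (forall x, t < x <= s -> ~ K x) -> cumul R K t s = 0.
Proof.
move=> H; rewrite /cumul (_ : _ `&` _ = set0) ?measure0 //.
by apply/seteqP; split=> x // -[Kx]; rewrite /= in_itv /= => /H.
Qed.

End Cumul.

(** * Nesting ever steeper chords *)

Lemma far_from_one (R : realType) (u v w K : R) : K <= `|u - v| ->
  K / 2 <= `|w - u| \/ K / 2 <= `|w - v|.
Proof.
move=> H; have [|h] := leP (K / 2) `|w - u|; first by left.
right; have : `|u - v| <= `|w - u| + `|w - v|.
  by rewrite -(distrC u w) (le_trans _ (ler_normD _ _)) // addrA subrK.
lra.
Qed.

(** The second clause covers all scales between the two chord lengths, so a nested sequence leaves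
    no gap. The loss from [N] to [N / 16] is a factor 4 from the flatness threshold, 2 from
    shrinking the radius and 2 from [far_from_one]. *)
Definition refines (R : realType) (f : R -> R) (a b N N' d a' b' : R) :=
  [/\ a <= a', a' < b', b' <= b, b' - a' < d & N' * (b' - a') <= `|f b' - f a'|] /\
  forall x r, a' <= x <= b' -> b' - a' <= r <= b - a ->
    exists2 y, `|x - y| <= r & N / 16 * r <= `|f x - f y|.

(** At scales below [2 * (b' - a')], the new chord has an end whose value is far from [f x]. At
    larger ones, take the steep chord from [x0] of radius [r - (b' - a')]: both its ends are within
    [r] of [x], and one has a value far from [f x]. *)
Lemma refines_endpoint (R : realType) (f : R -> R) (a b N N' d a' b' x0 : R) :
  0 < N -> N <= N' -> a <= a' -> a' < b' -> b' <= b -> b' - a' < d ->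
  N' * (b' - a') <= `|f b' - f a'| -> x0 = a' \/ x0 = b' ->
  (forall r, 0 < r <= b - a ->
    exists2 y, `|x0 - y| <= r & N / 4 * r <= `|f x0 - f y|) ->
  refines R f a b N N' d a' b'.
Proof.
move=> N0 NN aa' ab' bb' d' Hf x0E B; split=> // x r /andP[a'x xb'] /andP[sr rb].
have xa : `|x - a'| <= r by rewrite ger0_norm ?subr_ge0 //; lra.
have xb : `|x - b'| <= r by rewrite ler0_norm ?subr_le0 //; lra.
have xx0 : `|x - x0| <= b' - a'.
  by case: x0E => ->; [rewrite ger0_norm | rewrite ler0_norm]; lra.
have [rs|sr2] := ltP r (2 * (b' - a')).
  have K : N / 16 * r <= N' * (b' - a') / 2.
    have := ler_wpM2l (ltW N0) (ltW rs).
    have : N * (b' - a') <= N' * (b' - a') by rewrite ler_wpM2r // subr_ge0 ltW.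
    have : 0 <= N * (b' - a') by rewrite mulr_ge0 ?ltW // subr_gt0.
    lra.
  by case: (far_from_one _ _ _ (f x) _ Hf) => h; [exists b' | exists a'] => //; lra.
have [|y xy Hy] := B (r - (b' - a')); first by lra.
have K : N / 16 * r <= N / 4 * (r - (b' - a')) / 2.
  by have := ler_wpM2l (ltW N0) sr2; lra.
case: (far_from_one _ _ _ (f x) _ Hy) => h; last first.
  exists y; last by lra.
  have : `|x - y| <= `|x - x0| + `|x0 - y|.
    by rewrite (le_trans _ (ler_normD _ _)) // addrA subrK.
  lra.
by case: x0E h => -> h; [exists a' | exists b'] => //; lra.
Qed.

Lemma null_open_cover (R : realType) (Z : set R) (e : R) : measurable Z ->
  lebesgue_measure Z = 0%E -> 0 < e ->
  exists U : set R, [/\ open U, Z `<=` U & (lebesgue_measure U < e%:E)%E].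
Proof.
move=> mZ Z0 e0; have [|U [oU ZU Ue]] := lebesgue_regularity_outer mZ _ e0.
  by rewrite [ltLHS]Z0 ltry.
exists U; split => //; apply: le_lt_trans Ue.
rewrite -[in leLHS](setDUK ZU); apply: (le_trans (measureU2 _ _ _)) => //.
  by apply: measurableD => //; exact: measurable_realfun.open_measurable.
by rewrite [X in (X + _)%E]Z0 add0e.
Qed.

(* If no point of [a, b] starts a steep refinement, every point either has a
   scale at which [f] is flat, or is a point of local [N']-Lipschitzness, and
   the latter form a null set; real induction then bounds the increment. *)
Lemma steep_step (R : realType) (f : R -> R) (Z : set R) (a b N N' d : R) :
  continuous f -> measurable Z -> lebesgue_measure Z = 0%E ->
  (forall x, a < x < b -> ~ Z x -> Lip f x = +oo%E) ->
  a < b -> 0 < N -> N <= N' -> 0 < d -> N * (b - a) <= `|f b - f a| ->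
  exists a' b', refines R f a b N N' d a' b'.
Proof.
move=> cf mZ Z0 LZ ab N0 NN d0 Hf; apply: contrapT => nR.
have N'0 : 0 < N' by apply: lt_le_trans NN.
pose flat x := exists2 r, 0 < r <= b - a &
  forall y, a <= y <= b -> `|x - y| <= r -> `|f x - f y| < N / 4 * r.
(* A point with no flat scale can serve as [x0] in [refines_endpoint], so a chord from it shorter
   than [d] and of slope at least [N'] would contradict [nR]. *)
have nflat x y : a <= x <= b -> ~ flat x -> a <= y <= b -> 0 < `|x - y| < d ->
    `|f x - f y| < N' * `|x - y|.
  move=> /andP[ax xb] nF /andP[ay yb] /andP[xy0 xyd]; rewrite ltNge; apply/negP => Hxy.
  have B r : 0 < r <= b - a -> exists2 y, `|x - y| <= r & N / 4 * r <= `|f x - f y|.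
    move=> rab; apply: contrapT => h; apply: nF; exists r => // z _ xz.
    by rewrite ltNge; apply/negP => h'; apply: h; exists z.
  apply: nR; have [xy|yx|xy] := ltgtP x y; last by rewrite xy subrr normr0 ltxx in xy0.
    exists x, y; apply: (refines_endpoint _ _ _ _ _ _ _ _ _ x) => //; last by left.
      by move: xyd; rewrite distrC gtr0_norm // subr_gt0.
    by move: Hxy; rewrite (distrC x) (gtr0_norm (_ : 0 < y - x)) ?subr_gt0 // (distrC (f x)).
  exists y, x; apply: (refines_endpoint _ _ _ _ _ _ _ _ _ x) => //; last by right.
    by move: xyd; rewrite gtr0_norm // subr_gt0.
  by move: Hxy; rewrite (gtr0_norm (_ : 0 < x - y)) ?subr_gt0.
(* The left end [a] joins the null set because [LZ] speaks only of interior points. *)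
have Za0 : lebesgue_measure (Z `|` [set a]) = 0%E.
  apply/eqP; rewrite -measure_le0; apply: (le_trans (measureU2 _ _ _)) => //.
  by rewrite [X in (X + _)%E]Z0 add0e [leLHS](countable_lebesgue_measure0 (@countable1 _ a)).
have mZa : measurable (Z `|` [set a] : set (measurableTypeR R)).
  by apply: measurableU => //; exact: measurable_set1.
(* Chosen so that [N' * e] is a quarter of [N * (b - a)]. *)
pose e := N * (b - a) / (4 * N').
have e0 : 0 < e by rewrite divr_gt0 ?mulr_gt0 ?subr_gt0.
have [U [oU ZU Ue]] := null_open_cover _ _ _ mZa Za0 e0.
have mU : measurable (U : set (measurableTypeR R)) by exact: measurable_realfun.open_measurable.
pose m := cumul R U a.
(* The three terms pay for flat steps, for steps inside [U], and for one last flat step overshooting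
   [b]. At [b] each is at most [N / 4 * (b - a)], so their sum stays below the increment
   [N * (b - a)]. *)
pose phi t := N / 4 * (t - a) + N' * m t + (if b <= t then N / 4 * (b - a) else 0).
have N4 : 0 < N / 4 by lra.
have Nab : 0 < N / 4 * (b - a) by rewrite mulr_gt0 // subr_gt0.
have m_mono s t : a <= s <= t -> m s <= m t.
  by move=> st; rewrite /m (cumulD R U a mU _ _ st) lerDl cumul_ge0.
have phi_mono s t : a <= s <= t -> phi s <= phi t.
  move=> /[dup] /m_mono mst /andP[as_ st]; rewrite /phi !lerD //.
  - by rewrite ler_pM2l // lerB.
  - by rewrite ler_pM2l.
  - have [bs|sb] := leP b s; first by rewrite (le_trans bs st).
    by case: ifP => // _; exact: ltW.
suff : `|f b - f a| <= phi b.
  rewrite /phi lexx.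
  have : m b < e.
    rewrite -lte_fin fineK; last exact: cut_fin.
    apply: le_lt_trans Ue; apply: le_measure; rewrite ?inE //; exact: measurable_cut.
  rewrite /e ltr_pdivlMr; last by rewrite mulr_gt0.
  have := mulr_gt0 N0 (_ : 0 < b - a); rewrite subr_gt0 => /(_ ab).
  lra.
apply: (@real_induction _ a b (fun t => `|f t - f a| <= phi t)).
- exact: ltW.
- rewrite subrr normr0 /phi subrr mulr0 add0r (leNgt b a) ab addr0 mulr_ge0 ?(ltW N'0) //.
  exact: cumul_ge0.
- move=> t /andP[at_ tb] H; apply/ler_addgt0Pr => e1 e10.
  have /cvgrPdist_lt /(_ _ e10) [d1 /= d10 Hd1] := cf t.
  have [s /andP[ts st] [as_ Hs]] := H _ d10.
  have ts' : `|t - s| < d1 by rewrite ger0_norm ?subr_ge0 //; lra.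
  have := Hd1 _ ts'; have := phi_mono s t; rewrite as_ st => /(_ isT).
  have : `|f t - f a| <= `|f t - f s| + `|f s - f a|.
    by rewrite (le_trans _ (ler_normD _ _)) // addrA subrK.
  lra.
move=> t /andP[at_ tb] Ht.
have tri s : `|f s - f a| <= `|f t - f s| + `|f t - f a|.
  by rewrite (distrC (f t) (f s)) (le_trans _ (ler_normD _ _)) // addrA subrK.
have phit : phi t = N / 4 * (t - a) + N' * m t by rewrite /phi (leNgt b t) tb addr0.
have [[r /andP[r0 rb] Hr]|nF] := pselect (flat t).
  have [trb|btr] := leP (t + r) b.
    exists (t + r); first by rewrite trb ltrDl r0.
    have := Hr (t + r); rewrite opprD addrA subrr sub0r normrN gtr0_norm // lexx.
    have -> : a <= t + r <= b by rewrite trb andbT; lra.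
    move=> /(_ isT isT); have := tri (t + r).
    have := m_mono t (t + r); rewrite at_ lerDl (ltW r0) => /(_ isT).
    rewrite -(ler_pM2l N'0) /phi.
    have : 0 <= if b <= t + r then N / 4 * (b - a) else 0 by case: ifP => // _; exact: ltW.
    move: Ht; rewrite phit.
    lra.
  (* The flat scale reaches beyond [b]; the jump of [phi] at [b] pays for this step. *)
  exists b; first by rewrite tb lexx.
  have := Hr b; rewrite ltW //= lexx ler0_norm ?subr_le0 ?(ltW tb) // => /(_ isT).
  have -> : - (t - b) <= r by lra.
  move=> /(_ isT); have := tri b.
  have := m_mono t b; rewrite at_ (ltW tb) => /(_ isT).
  rewrite -(ler_pM2l N'0) /phi lexx.
  have := ler_wpM2l (ltW N4) rb.
  have : 0 <= N / 4 * (b - t) by rewrite mulr_ge0 ?ltW // subr_gt0.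
  move: Ht; rewrite phit.
  lra.
have tI : a <= t <= b by rewrite at_ ltW.
(* Elsewhere [Lip f t] is infinite, which gives a short chord of slope [N'] inside [[a, b]], against
   [nflat]. *)
have Zt : (Z `|` [set a]) t.
  apply: contrapT => nZ.
  have nZ1 : ~ Z t by move=> h; apply: nZ; left.
  have at' : a < t.
    by rewrite lt_neqAle at_ andbT; apply/eqP => h; apply: nZ; right.
  have LT : Lip f t = +oo%E by apply: LZ => //; rewrite at' tb.
  have /Lip_ooP /(_ N' (Num.min d (Num.min (t - a) (b - t)))) [] := LT.
    by rewrite !lt_min d0 !subr_gt0 at' tb.
  move=> y; rewrite !lt_min => /andP[ty0 /and3P[tyd tya tyb]].
  apply/negP; rewrite -ltNge; apply: nflat => //; last by rewrite ty0 tyd.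
  move: tya tyb; rewrite !ltr_norml => /andP[h1 h2] /andP[h3 h4].
  by apply/andP; split; lra.
have := oU; rewrite openE => /(_ _ (ZU _ Zt)) [e1 /= e10 He1].
(* So close to [t] that []t, s]] lies in [U], where [m] grows at rate 1, and that the chord is
   shorter than [d]. *)
pose s := Num.min (t + e1 / 2) (Num.min (t + d / 2) b).
have ts : t < s by rewrite /s !lt_min tb andbT; apply/andP; split; lra.
have sb : s <= b by rewrite /s !ge_min lexx !orbT.
have sd : s <= t + d / 2 by rewrite /s !ge_min lexx !orbT.
have se : s <= t + e1 / 2 by rewrite /s !ge_min lexx.
exists s; first by rewrite ts sb.
have : `|f t - f s| < N' * `|t - s|.
  apply: nflat => //; first by apply/andP; split; lra.
  by rewrite ltr0_norm ?subr_lt0 //; lra.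
rewrite (ltr0_norm (_ : t - s < 0)) ?subr_lt0 // => Hs.
have := tri s.
have : m s = m t + (s - t).
  rewrite /m (cumulD R U a mU t s) ?at_ ?(ltW ts) //; congr (_ + _).
  apply: cumul_full; first exact: ltW.
  move=> z /=; rewrite in_itv /= => /andP[tz zs]; apply: He1 => /=.
  by rewrite ltr0_norm ?subr_lt0 //; lra.
rewrite /phi => ->.
have : 0 <= if b <= s then N / 4 * (b - a) else 0 by case: ifP => // _; exact: ltW.
move: Ht; rewrite phit.
have : 0 <= N / 4 * (s - t) by rewrite mulr_ge0 ?ltW // subr_gt0.
lra.
Qed.

(** Iterating [steep_step] with slopes [n+1] gives nested chords with a common point [x]. Each small
    [r] lies between two consecutive chord lengths, and the corresponding refinement supplies a
    steep chord from [x] at scale [r]. *)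
Lemma lip_oo_of_Lip_oo_ae (R : realType) (f : R -> R) (Z : set R) (a0 b0 : R) :
  continuous f -> measurable Z -> lebesgue_measure Z = 0%E -> a0 < b0 ->
  (forall x, a0 < x < b0 -> ~ Z x -> Lip f x = +oo%E) ->
  exists x, lip f x = +oo%E.
Proof.
move=> cf mZ Z0 ab0 LZ.
pose valid n (p : R * R) := [/\ a0 < p.1, p.1 < p.2, p.2 < b0 &
  n.+1%:R * (p.2 - p.1) <= `|f p.2 - f p.1|].
have [p0 v0] : exists p, valid 0 p.
  have [x0 /andP[ax xb] nZx] : exists2 x, a0 < x < b0 & ~ Z x.
    apply: contrapT => h.
    have : (lebesgue_measure (`]a0, b0[%classic : set R) <= lebesgue_measure Z)%E.
      apply: le_measure; rewrite ?inE // => x /=; rewrite in_itv /= => xI.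
      by apply: contrapT => nZ; apply: h; exists x.
    rewrite [X in (_ <= X)%E]Z0 lebesgue_measure_itv /= lte_fin ab0 lee_fin.
    by rewrite leNgt subr_gt0 ab0.
  have /Lip_ooP LT : Lip f x0 = +oo%E by apply: LZ => //; rewrite ax xb.
  have [|y] := LT 1 (Num.min (x0 - a0) (b0 - x0)).
    by rewrite lt_min !subr_gt0 ax xb.
  rewrite lt_min !ltr_norml => /andP[xy0 /andP[/andP[h1 h2] /andP[h3 h4]]] Hy.
  have [xy|yx|xy] := ltgtP x0 y; last by rewrite xy subrr normr0 ltxx in xy0.
    exists (x0, y); split => //=; first by lra.
    by rewrite -(gtr0_norm (_ : 0 < y - x0)) ?subr_gt0 // distrC (distrC (f y)).
  exists (y, x0); split => //=; first by lra.
  by rewrite -(gtr0_norm (_ : 0 < x0 - y)) ?subr_gt0.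
have step (np : nat * (R * R)) : exists p', valid np.1 np.2 -> valid np.1.+1 p' /\
    refines R f np.2.1 np.2.2 np.1.+1%:R np.1.+2%:R np.1.+1%:R^-1 p'.1 p'.2.
  case: np => n [a b]; have [[/= aa0 ab bb0 Hf]|nv] := pselect (valid n (a, b)); last first.
    (* A dummy value: [choice] needs a successor for invalid pairs too. *)
    by exists (0, 0) => /nv.
  have [|||||a' [b' r]] := @steep_step R f Z a b n.+1%:R n.+2%:R n.+1%:R^-1 cf mZ Z0 _ ab.
  - by move=> x /andP[ax xb]; apply: LZ; rewrite (lt_trans aa0 ax) (lt_trans xb bb0).
  - by [].
  - by rewrite ler_nat.
  - by rewrite invr_gt0.
  - exact: Hf.
  exists (a', b') => _; split => //; case: (r) => -[h1 h2 h3 h4 h5] _; split => //=.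
    exact: lt_le_trans h1.
  exact: le_lt_trans bb0.
have [F HF] := choice step.
pose s := fix s n := if n is m.+1 then F (m, s m) else p0.
have sv n : valid n (s n) by elim: n => //= n /(HF (n, s n))[].
have sr n : refines R f (s n).1 (s n).2 n.+1%:R n.+2%:R n.+1%:R^-1 (s n.+1).1 (s n.+1).2.
  by have [] := HF (n, s n) (sv n).
have lt12 n : (s n).1 < (s n).2 by have [] := sv n.
have nest m n : (m <= n)%N -> (s m).1 <= (s n).1 /\ (s n).2 <= (s m).2.
  elim: n => [|n IH]; first by rewrite leqn0 => /eqP->.
  rewrite leq_eqVlt => /orP[/eqP-> //|/IH[h1 h2]].
  by have [[h3 _ h4 _ _] _] := sr n; split; [exact: le_trans h3 | exact: le_trans h2].
have cross m n : (s m).1 <= (s n).2.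
  have [mn|/ltnW nm] := leqP m n.
    exact: le_trans (nest _ _ mn).1 (ltW (lt12 _)).
  exact: le_trans (ltW (lt12 _)) (nest _ _ nm).2.
pose S := [set (s n).1 | n in [set: nat]].
have ubS n : ubound S (s n).2 by move=> _ [m _ <-].
have hS : has_sup S by split; [exists (s 0%N).1, 0%N | exists (s 0%N).2].
pose x := sup S.
have xI n : (s n).1 <= x <= (s n).2.
  apply/andP; split; first by apply: ub_le_sup; [case: hS | exists n].
  by apply: ge_sup => //; case: hS.
exists x; apply: lip_oo => N.
(* From this index on, the guaranteed slope [(n+1) / 16] exceeds [N]. *)
pose n0 := (Num.trunc (16 * `|N|)).+1.
exists ((s n0).2 - (s n0).1); first by rewrite subr_gt0.
move=> r /andP[r0 rs].
have ex : exists n, (s n).2 - (s n).1 < r.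
  exists (Num.trunc r^-1).+2.
  have [[_ _ _ h _] _] := sr (Num.trunc r^-1).+1.
  apply: lt_trans h _; rewrite invf_plt ?posrE //.
  by apply: lt_trans (Num.Theory.truncnS_gt _) _; rewrite ltr_nat.
(* By minimality, the preceding chord still has length at least [r]. *)
have [n Hn Hmin] := ex_minnP ex.
have n0n : (n0 < n)%N.
  rewrite ltnNge; apply/negP => /nest[h1 h2].
  have : (s n0).2 - (s n0).1 <= (s n).2 - (s n).1 by rewrite lerB.
  lra.
case: n n0n Hn Hmin => // n n0n Hn Hmin.
have rn : r <= (s n).2 - (s n).1.
  by rewrite leNgt; apply/negP => /Hmin; rewrite ltnn.
have [_ /(_ x r)] := sr n; rewrite xI rn ltW // => /(_ isT isT)[y xy Hy].
exists y => //; apply: le_trans Hy; rewrite ler_pM2r //.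
rewrite ler_pdivlMr // mulrC.
have : 16 * N <= 16 * `|N| by rewrite ler_pM2l // ler_norm.
move/le_trans; apply; apply/ltW/(lt_le_trans (Num.Theory.truncnS_gt _)).
by rewrite ler_nat; exact: leq_trans n0n (leqnSn _).
Qed.

(** * Trimness of [L_inf f] *)

Lemma lebesgue_outer_ltE (R : realType) (E : set R) (a b : R) : a < b -> measurable E ->
  (lebesgue_outer (E `&` `]a, b[) < (b - a)%:E)%E =
  (0 < lebesgue_measure (~` E `&` `]a, b[))%E.
Proof.
move=> ab mE.
have mA : measurable (E `&` `]a, b[ : set (measurableTypeR R)) by exact: measurableI.
have mB : measurable (~` E `&` `]a, b[ : set (measurableTypeR R)).
  by apply: measurableI => //; exact: measurableC.
have tot : (lebesgue_measure (E `&` `]a, b[) + lebesgue_measure (~` E `&` `]a, b[) =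
    (b - a)%:E)%E.
  rewrite -measureU //.
    by rewrite -setIUl setUv setTI [LHS]lebesgue_measure_itv /= lte_fin ab.
  by apply/seteqP; split=> z // -[[h _] [h' _]].
(* Lebesgue measure is this outer measure by conversion. *)
rewrite /lebesgue_outer -[X in (X < _)%E]/(lebesgue_measure (E `&` `]a, b[)).
move: tot; have : (0 <= lebesgue_measure (E `&` `]a, b[))%E by [].
have : (0 <= lebesgue_measure (~` E `&` `]a, b[))%E by [].
case: (lebesgue_measure (E `&` _)) => [u| |] //; case: (lebesgue_measure _) => [v| |] //=.
rewrite !lee_fin => v0 u0 [] <-.
by rewrite !lte_fin ltrDl.
Qed.

(** Were trimness to fail on []a, b[], the complement of [L_inf f] would be null there, and [lip f]
    would be infinite somewhere. *)
Lemma trim_L_inf (R : realType) (f : R -> R) : continuous f -> l_inf f = set0 ->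
  trim (L_inf f).
Proof.
move=> cf lf a b ab.
have mL : measurable (L_inf f : set (measurableTypeR R)).
  by apply: Gdelta_measurable; exact: Gdelta_L_inf.
rewrite lebesgue_outer_ltE // lt_neqAle measure_ge0 andbT.
apply/negP => /eqP H.
have [||||x xoo] := @lip_oo_of_Lip_oo_ae R f (~` L_inf f `&` `]a, b[) a b cf.
- by apply: measurableI => //; exact: measurableC.
- by rewrite -H.
- exact: ab.
- move=> x xab nZ; apply: contrapT => nL; apply: nZ; split; [exact: nL | by rewrite /= in_itv].
have : l_inf f x by [].
by rewrite lf.
Qed.

(** * Cantor-type bumps carried by a closed set *)

Section Bump.
Variables (R : realType) (K : set R) (a b : R).
Hypotheses (ab : a < b) (cK : closed K) (Kab : K `<=` `]a, b[).
Hypothesis (K0 : (0 < lebesgue_measure K)%E).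

Let mK : measurable (K : set (measurableTypeR R)).
Proof. exact: measurable_realfun.closed_measurable. Qed.

Let g := cumul R K a.

Let Kitv z : K z -> a < z < b.
Proof. by move=> /Kab /=; rewrite in_itv. Qed.

Lemma cumul_split (s t : R) : s <= t -> g t = g s + cumul R K s t.
Proof.
move=> st; have [as_|sa] := leP a s; first by apply: cumulD; rewrite // as_.
rewrite {2}/g cumul_empty; last by move=> x /andP[/lt_le_trans h /h]; rewrite ltNge (ltW sa).
rewrite add0r /g /cumul; congr (fine (lebesgue_measure _)); apply/seteqP; split=> z /= [Kz];
  rewrite !in_itv /= => /andP[h1 h2]; split=> //; rewrite h2 andbT.
  exact: lt_trans h1.
by case/andP: (Kitv _ Kz).
Qed.

Lemma cumul_lip (s t : R) : `|g s - g t| <= `|s - t|.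
Proof.
wlog st : s t / s <= t.
  by move=> H; case/orP: (le_total s t) => h; [|rewrite distrC (distrC s)]; exact: H.
rewrite (cumul_split _ _ st) opprD addrA subrr sub0r normrN (distrC s) !ger0_norm ?subr_ge0 //.
  exact: cumul_le.
exact: cumul_ge0.
Qed.

Lemma cumul_flat (s t : R) : s <= t -> (forall z, s <= z <= t -> ~ K z) -> g s = g t.
Proof.
move=> st H; rewrite (cumul_split _ _ st) cumul_empty ?addr0 // => x /andP[sx xt].
by apply: H; rewrite (ltW sx).
Qed.

Let M := fine (lebesgue_measure K).

Let gb t : b <= t -> g t = M.
Proof.
move=> bt; rewrite /g /cumul setIidl // => z /Kitv /andP[az zb].
by rewrite /= in_itv /= az (le_trans (ltW zb)).
Qed.

Let ga t : t <= a -> g t = 0.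
Proof. by move=> ta; apply: cumul_empty => x /andP[/lt_le_trans h /h]; rewrite ltNge ta. Qed.

Let M0 : 0 < M.
Proof.
rewrite -lte_fin fineK // ge0_fin_numE //.
apply: (@le_lt_trans _ _ (lebesgue_measure (`]a, b[%classic : set R))).
  by apply: le_measure; rewrite ?inE.
by rewrite lebesgue_measure_itv /= lte_fin ab ltry.
Qed.

Let g_mono s t : s <= t -> g s <= g t.
Proof. by move=> st; rewrite (cumul_split _ _ st) lerDl cumul_ge0. Qed.

Let gM t : 0 <= g t <= M.
Proof.
rewrite cumul_ge0 /=; case/orP: (le_total t b) => tb.
  by rewrite -(gb b) // g_mono.
by rewrite gb.
Qed.

(** The last point where [g] is at most [c] works: off the closed set [K], [g] would stay constant a
    little further to the right. *)
Lemma cumul_level (c : R) : 0 <= c -> c < M -> exists2 y, K y & g y = c.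
Proof.
move=> c0 cM; pose S := [set t | g t <= c].
have Sa : S a by rewrite /S /= ga.
have ubS : ubound S b.
  move=> t St; rewrite leNgt; apply/negP => /ltW /gb h; have : g t <= c := St.
  by rewrite h leNgt cM.
have hS : has_sup S by split; [exists a | exists b].
have Sle t : S t -> t <= sup S by apply: ub_le_sup; case: hS.
have gle : g (sup S) <= c.
  apply/ler_addgt0Pr => e e0; have [t St ht] := sup_adherent e0 hS.
  have := cumul_lip (sup S) t; rewrite (ger0_norm (_ : 0 <= sup S - t)) ?subr_ge0 ?Sle //.
  move/(le_trans (ler_norm _)); have : g t <= c by [].
  lra.
exists (sup S); last first.
  apply/eqP; rewrite eq_le gle /=; apply/ler_addgt0Pr => e e0.
  have : c < g (sup S + e).
    by rewrite ltNge; apply/negP => /Sle; rewrite gerDl leNgt e0.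
  have := cumul_lip (sup S + e) (sup S).
  rewrite addrAC subrr add0r (gtr0_norm e0) => /(le_trans (ler_norm _)).
  lra.
apply: contrapT => nK.
have /closed_openC := cK; rewrite openE => /(_ _ nK) [e /= e0 He].
have /Sle : S (sup S + e / 2).
  rewrite /S /= -(cumul_flat (sup S)) //; first by lra.
  move=> z /andP[h1 h2]; apply: He => /=.
  by rewrite ler0_norm ?subr_le0 //; lra.
lra.
Qed.

(* A tent map of the normalized distribution function of Lebesgue measure on [K]. *)
Lemma bump_exists : exists (beta : R -> R) (C : R),
  [/\ 0 <= C, forall x, 0 <= beta x <= 1,
      forall x, x <= a \/ b <= x -> beta x = 0 &
      forall x y, `|beta x - beta y| <= C * `|x - y|] /\
  [/\ forall u v, u <= v -> (forall z, u <= z <= v -> ~ K z) -> beta u = beta v,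
      exists2 y, K y & beta y = 0 & exists2 y, K y & beta y = 1].
Proof.
exists (fun x => 1 - `|2 * (g x / M) - 1|), (2 / M).
have q01 x : 0 <= g x / M <= 1.
  by have /andP[h1 h2] := gM x; rewrite divr_ge0 ?(ltW M0) //= ler_pdivrMr // mul1r.
have M1 : M / M = 1 by rewrite divff // gt_eqF.
split; split.
- by rewrite divr_ge0 // ltW.
- move=> x; have /andP[h1 h2] := q01 x; apply/andP; split.
    by rewrite subr_ge0 ler_norml; apply/andP; split; lra.
  by rewrite gerBl.
- move=> x [/ga|/gb] ->; rewrite ?mul0r ?M1.
    by rewrite mulr0 sub0r normrN normr1 subrr.
  by rewrite mulr1 (_ : 2 - 1 = 1) ?normr1 ?subrr //; lra.
- move=> x y; rewrite (_ : _ - _ - _ = `|2 * (g y / M) - 1| - `|2 * (g x / M) - 1|); last by lra.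
  apply: (le_trans (ler_dist_dist _ _)).
  rewrite (_ : _ - _ - _ = (2 / M) * (g y - g x)); last by lra.
  rewrite normrM gtr0_norm ?divr_gt0 // ler_pM2l ?divr_gt0 // distrC; exact: cumul_lip.
- by move=> u v uv H; rewrite (cumul_flat _ _ uv H).
- have [y Ky gy] := cumul_level _ (lexx 0) M0; exists y => //.
  by rewrite gy mul0r mulr0 sub0r normrN normr1 subrr.
- have [||y Ky gy] := cumul_level (M / 2); [by have := M0; lra | by have := M0; lra |]; exists y => //.
  by rewrite gy mulrAC M1 mul1r divff ?pnatr_eq0 // subrr normr0 subr0.
Qed.

End Bump.

(** * Dyadic intervals [[dy k j, dy k (j + 1)]] *)

Definition dy (R : realType) (k : nat) (j : int) : R := j%:~R / 2 ^+ k.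

Section Dyadic.
Variable R : realType.
Local Notation dy := (dy R).

Lemma dyS (k : nat) (j : int) : dy k (j + 1) = dy k j + 2 ^- k.
Proof. by rewrite /dy intrD mulrDl mul1r. Qed.

(** Over the common denominator [2 ^ k'] the ends are integers, for which [i < j + 1] means
    [i <= j]. *)
Lemma dy_nested (k k' : nat) (j j' : int) : (k <= k')%N ->
  dy k j < dy k' (j' + 1) -> dy k' j' < dy k (j + 1) ->
  dy k j <= dy k' j' /\ dy k' (j' + 1) <= dy k (j + 1).
Proof.
move=> kk'; have [m ->] : exists m, k' = (m + k)%N by exists (k' - k)%N; rewrite subnK.
have E i : dy k i = dy (m + k) (i * 2 ^+ m).
  by rewrite /dy exprD intrM rmorphXn /= invfM mulrA mulfK ?expf_neq0 ?pnatr_eq0.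
rewrite !E /dy !ltr_pM2r ?invr_gt0 ?exprn_gt0 // !ler_pM2r ?invr_gt0 ?exprn_gt0 //.
by rewrite !ltr_int !ler_int !ltzD1 -!lezD1.
Qed.

Lemma dy_inj (k : nat) (j j' : int) :
  dy k j < dy k (j' + 1) -> dy k j' < dy k (j + 1) -> j = j'.
Proof.
rewrite /dy !ltr_pM2r ?invr_gt0 ?exprn_gt0 // !ltr_int !ltzD1 => h1 h2.
by apply/eqP; rewrite eq_le h1.
Qed.

Lemma dy_small (e : R) : 0 < e -> exists k : nat, 2 ^- k <= e.
Proof.
move=> e0; exists (Num.trunc e^-1).+1.
rewrite -[leRHS]invrK lef_pV2 ?posrE ?invr_gt0 ?exprn_gt0 //.
apply/ltW/(lt_le_trans (Num.Theory.truncnS_gt _)).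
by rewrite -natrX ler_nat ltnW // ltn_expl.
Qed.

End Dyadic.

(** * One layer: bumps on a Whitney decomposition *)

Section Whitney.
Variables (R : realType) (F Q : set R) (N eps : R).
Hypotheses (cQ : closed Q) (QF : Q `<=` F) (N0 : 0 < N) (eps0 : 0 < eps).
Local Notation dy := (dy R).
Variables (K : nat -> int -> set R) (beta : nat -> int -> R -> R) (C : nat -> int -> R).
Hypothesis (cK : forall k j, closed (K k j)).
Hypothesis (KF : forall k j, K k j `<=` F).
Hypothesis (Kdy : forall k j z, K k j z -> dy k j < z < dy k (j + 1)).
Hypothesis (C0 : forall k j, 0 <= C k j).
Hypothesis (b01 : forall k j x, 0 <= beta k j x <= 1).
Hypothesis (bend : forall k j x, x <= dy k j \/ dy k (j + 1) <= x -> beta k j x = 0).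
Hypothesis (blip : forall k j x y, `|beta k j x - beta k j y| <= C k j * `|x - y|).
Hypothesis (bflat : forall k j u v, u <= v ->
  (forall z, u <= z <= v -> ~ K k j z) -> beta k j u = beta k j v).
Hypothesis (blow : forall k j, exists2 y, K k j y & beta k j y = 0).
Hypothesis (bhigh : forall k j, exists2 y, K k j y & beta k j y = 1).

(** Height of the bump on a tile of generation [k]: half of it, over the width of the tile, is slope
    [N]. *)
Let lam (k : nat) : R := 2 * N * 2 ^- k.

(** The interval is so far from [Q] that a bump on it stays below [eps] times the distance to
    [Q]. *)
Let good k j := forall y q, dy k j <= y <= dy k (j + 1) -> Q q -> lam k <= eps * `|y - q|.

(* The maximal good dyadic intervals: a Whitney decomposition of the complement of [Q]. *)
Let tile k j := good k j /\ forall k' j', (k' < k)%N ->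
  dy k' j' <= dy k j -> dy k (j + 1) <= dy k' (j' + 1) -> ~ good k' j'.

Let p2 k : 0 < 2 ^- k :> R.
Proof. by rewrite invr_gt0 exprn_gt0. Qed.

Let lam0 k : 0 < lam k.
Proof. by rewrite !mulr_gt0. Qed.

Let dylt k j : dy k j < dy k (j + 1).
Proof. by rewrite dyS ltrDl. Qed.

Let tile_uniq k j k' j' : tile k j -> tile k' j' ->
  dy k j < dy k' (j' + 1) -> dy k' j' < dy k (j + 1) -> k = k' /\ j = j'.
Proof.
wlog kk' : k j k' j' / (k <= k')%N.
  move=> H t t' h h'; case/orP: (leq_total k k') => kk'; first exact: H.
  by have [-> ->] := H _ _ _ _ kk' t' t h' h.
move=> [gk _] [_ mk'] h h'; have [h1 h2] := dy_nested _ _ _ _ _ kk' h h'.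
move: kk'; rewrite leq_eqVlt => /orP[/eqP kk'|kk']; last by case: (mk' _ _ kk' h1 h2).
by subst k'; split=> //; exact: dy_inj h h'.
Qed.

(** Generations are natural numbers, so there is a coarsest good interval containing the given
    one. *)
Let tile_ex k j : good k j -> exists k' j',
  [/\ tile k' j', dy k' j' <= dy k j & dy k (j + 1) <= dy k' (j' + 1)].
Proof.
move=> gk.
pose A k' := `[< exists j', [/\ good k' j', dy k' j' <= dy k j &
  dy k (j + 1) <= dy k' (j' + 1)] >].
have exA : exists k', A k' by exists k; apply/asboolP; exists j; split.
have [k' /asboolP[j' [g' h1 h2]] Hmin] := ex_minnP exA.
exists k', j'; split => //; split => // k1 j1 k1k' h3 h4 g1.
have : (k' <= k1)%N.
  by apply: Hmin; apply/asboolP; exists j1; split => //; [exact: le_trans h1 | exact: le_trans h4].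
by rewrite leqNgt k1k'.
Qed.

(** The fine dyadic interval containing [x] and its left neighbour are good and extend to tiles,
    which may coincide; [c] is their common end. Two tiles suffice because [x] may be a left end but
    never a right end. *)
Let near_tiles x : ~ Q x -> exists e c k1 j1 k2 j2, [/\ 0 < e, c <= x, tile k1 j1, tile k2 j2 &
  [/\ dy k1 j1 <= c, x + e <= dy k1 (j1 + 1), dy k2 j2 <= x - e & c <= dy k2 (j2 + 1)]].
Proof.
move=> nQ; have /closed_openC := cQ; rewrite openE => /(_ _ nQ) [d /= d0 Hd].
have {}Hd q : Q q -> d <= `|x - q|.
  by move=> Qq; rewrite leNgt; apply/negP => /Hd; exact.
(* The first bound keeps both intervals within [d / 2] of [x]; the second makes [lam k] at most
   [eps * (d / 2)]. *)
have [|k Hk] := dy_small R (Num.min (d / 4) (eps * (d / 2) / (2 * N))).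
  by rewrite lt_min !divr_gt0 // ?mulr_gt0 // divr_gt0.
move: Hk; rewrite le_min => /andP[k1 k2].
pose j := Num.floor (x * 2 ^+ k).
have jx : dy k j <= x < dy k (j + 1).
  rewrite /dy ler_pdivrMr ?exprn_gt0 // ltr_pdivlMr ?exprn_gt0 //.
  by rewrite floor_le_tmp floorD1_gt.
have S := dyS R k j; have S' := dyS R k (j - 1); rewrite subrK in S'.
case/andP: jx => jx xj; have p2k := p2 k.
have G i : x - 2 * 2 ^- k <= dy k i -> dy k (i + 1) <= x + 2 * 2 ^- k -> good k i.
  move=> h1 h2 y q /andP[yi iy] /Hd dq.
  have : `|y - q| >= d / 2.
    have : `|x - q| <= `|x - y| + `|y - q|.
      by rewrite (le_trans _ (ler_normD _ _)) // addrA subrK.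
    have : `|x - y| <= 2 * 2 ^- k by rewrite ler_norml; apply/andP; split; lra.
    lra.
  rewrite -(ler_pM2l eps0); apply: le_trans.
  by move: k2; rewrite ler_pdivlMr ?mulr_gt0 // mulrC.
have [||t1 [i1 [T1 h1 h2]]] := tile_ex k j (G j _ _); [lra | lra |].
have [||t2 [i2 [T2 h3 h4]]] := tile_ex k (j - 1) (G (j - 1) _ _); [lra | rewrite subrK; lra |].
rewrite subrK in h4.
exists (Num.min (2 ^- k) (dy k (j + 1) - x)), (dy k j), t1, i1, t2, i2.
have m1 : Num.min (2 ^- k) (dy k (j + 1) - x) <= 2 ^- k by rewrite ge_min lexx.
have m2 : Num.min (2 ^- k) (dy k (j + 1) - x) <= dy k (j + 1) - x by rewrite ge_min lexx orbT.
split => //; first by rewrite lt_min p2k subr_gt0.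
by split => //; lra.
Qed.

Let tileQ k j y : tile k j -> dy k j <= y <= dy k (j + 1) -> ~ Q y.
Proof.
move=> [gk _] yI Qy; have := gk _ _ yI Qy.
by rewrite subrr normr0 mulr0 leNgt lam0.
Qed.

Let P : set R := [set x | Q x \/ exists k j, tile k j /\ K k j x].

Let tileP k j x : tile k j -> dy k j <= x <= dy k (j + 1) -> P x -> K k j x.
Proof.
move=> T xI [/(tileQ _ _ _ T xI) //|[k' [j' [T' Kx]]]].
have /andP[h1 h2] := Kdy _ _ _ Kx; case/andP: xI => h3 h4.
by have [-> ->] := tile_uniq k j k' j' T T' (le_lt_trans h3 h2) (lt_le_trans h1 h4).
Qed.

(** Off [Q], only two of the closed sets [K k j] are relevant near a given point. *)
Let closedP : closed P.
Proof.
rewrite -[P]setCK; apply: open_closedC; rewrite openE => x nP.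
have nQ : ~ Q x by move=> h; apply: nP; left.
have [e [c [k1 [j1 [k2 [j2 [e0 cx T1 T2 [h1 h2 h3 h4]]]]]]]] := near_tiles x nQ.
have O12 : open (~` (K k1 j1 `|` K k2 j2)).
  by apply: closed_openC; apply: closedU.
have nK : (~` (K k1 j1 `|` K k2 j2)) x.
  by move=> [h|h]; apply: nP; right; [exists k1, j1 | exists k2, j2].
move: O12; rewrite openE => /(_ _ nK) [d /= d0 Hd].
exists (Num.min d e); first by rewrite /= lt_min d0.
move=> y /=; rewrite lt_min => /andP[xyd] /[dup] xye.
rewrite ltr_norml => /andP[h5 h6] Py.
have nKy : ~ (K k1 j1 `|` K k2 j2) y by apply: Hd.
have [cy|yc] := leP c y.
  by apply: nKy; left; apply: tileP => //; apply/andP; split; lra.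
by apply: nKy; right; apply: tileP => //; apply/andP; split; lra.
Qed.

(** [g] is [lam k * beta k j] on each tile and 0 elsewhere. For the steep chord, [beta] takes the
    values 0 and 1 on [K k j], and one of them is at least 1/2 away from its value at [x]. *)
Lemma whitney_layer : exists g : R -> R,
  [/\ forall y q, Q q -> `|g y| <= eps * `|y - q|,
      forall x, exists L d, 0 < d /\ forall y, `|x - y| < d -> `|g x - g y| <= L * `|x - y|,
      forall u v, u <= v -> (forall z, u <= z <= v -> ~ P z) -> g u = g v &
      forall x, ~ P x -> exists y, [/\ P y, N * `|x - y| <= `|g x - g y| &
         forall q, Q q -> 2 * N * `|x - y| <= eps * `|x - q|]].
Proof.
have Hex x : exists v : R,
    (exists k j, [/\ tile k j, dy k j < x < dy k (j + 1) & v = lam k * beta k j x]) \/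
    ((forall k j, tile k j -> ~ (dy k j < x < dy k (j + 1))) /\ v = 0).
  have [[k [j [T xI]]]|h] := pselect (exists k j, tile k j /\ dy k j < x < dy k (j + 1)).
    by exists (lam k * beta k j x); left; exists k, j.
  by exists 0; right; split => // k j T xI; apply: h; exists k, j.
have [g Hg] := choice Hex.
have gT k j x : tile k j -> dy k j <= x <= dy k (j + 1) -> g x = lam k * beta k j x.
  move=> T /andP[h1 h2]; case: (Hg x) => [[k' [j' [T' /andP[h3 h4] ->]]]|[H ->]].
    by have [-> ->] := tile_uniq k j k' j' T T' (le_lt_trans h1 h4) (lt_le_trans h3 h2).
  rewrite bend ?mulr0 //; have [xj|jx] := leP x (dy k j); first by left.
  by right; rewrite leNgt; apply/negP => xj; apply: (H _ _ T); rewrite jx.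
have gL k j x y : tile k j -> dy k j <= x <= dy k (j + 1) -> dy k j <= y <= dy k (j + 1) ->
    `|g x - g y| <= lam k * C k j * `|x - y|.
  move=> T xI yI; rewrite (gT _ _ _ T xI) (gT _ _ _ T yI) -mulrBr normrM (gtr0_norm (lam0 k)).
  by rewrite -mulrA ler_pM2l.
have lamC k j : 0 <= lam k * C k j by rewrite mulr_ge0 // ltW.
have gQ y q : Q q -> `|g y| <= eps * `|y - q|.
  move=> Qq; case: (Hg y) => [[k [j [[gk _] /andP[h1 h2] ->]]]|[_ ->]].
    have /andP[b0 b1] := b01 k j y.
    rewrite (ger0_norm (mulr_ge0 (ltW (lam0 k)) b0)).
    apply: (@le_trans _ _ (lam k)); first by rewrite ger_pMr.
    by apply: gk => //; rewrite !ltW.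
  by rewrite normr0 mulr_ge0 // ltW.
(* Local constancy off [P]; real induction later extends it to whole intervals. *)
have gflat x : ~ P x -> exists2 e, 0 < e & forall y, `|x - y| < e -> g y = g x.
  move=> nP; have nQ : ~ Q x by move=> h; apply: nP; left.
  have [e [c [k1 [j1 [k2 [j2 [e0 cx T1 T2 [h1 h2 h3 h4]]]]]]]] := near_tiles x nQ.
  have /closed_openC := closedP; rewrite openE => /(_ _ nP) [d /= d0 Hd].
  have flat k j u v : tile k j -> dy k j <= u -> u <= v -> v <= dy k (j + 1) ->
      `|x - u| < d -> `|x - v| < d -> g u = g v.
    move=> T ju uv vj; rewrite !ltr_norml => /andP[h5 h6] /andP[h7 h8].
    rewrite !(gT k j) //; [|by apply/andP; split; lra..].
    congr (_ * _); apply: bflat => // z /andP[uz zv] Kz.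
    apply: (Hd z); last by right; exists k, j.
    by rewrite /= ltr_norml; apply/andP; split; lra.
  exists (Num.min e d); first by rewrite lt_min e0.
  move=> y; rewrite lt_min => /andP[]; rewrite ltr_norml => /andP[h5 h6] xyd.
  have xxd : `|x - x| < d by rewrite subrr normr0.
  have [cy|yc] := leP c y.
    have [xy|yx] := leP x y.
      by apply/esym; apply: (flat k1 j1) => //; lra.
    by apply: (flat k1 j1) => //; lra.
  have xcd : `|x - c| < d.
    move: xyd; rewrite !ltr_norml => /andP[h7 h8]; apply/andP; split; lra.
  transitivity (g c).
    by apply: (flat k2 j2) => //; lra.
  by apply: (flat k1 j1) => //; lra.
exists g; split => //.
- move=> x; have [Qx|nQ] := pselect (Q x).
    exists eps, 1; split => // y _; have := gQ x _ Qx.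
    rewrite subrr normr0 mulr0 normr_le0 => /eqP ->.
    by rewrite sub0r normrN distrC; exact: gQ.
  have [e [c [k1 [j1 [k2 [j2 [e0 cx T1 T2 [h1 h2 h3 h4]]]]]]]] := near_tiles x nQ.
  exists (lam k1 * C k1 j1 + lam k2 * C k2 j2), e; split => // y.
  rewrite ltr_norml => /andP[h5 h6]; rewrite mulrDl.
  have xI : dy k1 j1 <= x <= dy k1 (j1 + 1) by apply/andP; split; lra.
  have [cy|yc] := leP c y.
    have yI : dy k1 j1 <= y <= dy k1 (j1 + 1) by apply/andP; split; lra.
    by apply: (le_trans (gL _ _ _ _ T1 xI yI)); rewrite lerDl mulr_ge0.
  apply: (@le_trans _ _ (`|g x - g c| + `|g c - g y|)).
    by rewrite (le_trans _ (ler_normD _ _)) // addrA subrK.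
  apply: lerD.
    apply: (@le_trans _ _ (lam k1 * C k1 j1 * `|x - c|)).
      by apply: gL => //; apply/andP; split; lra.
    by rewrite ler_wpM2l // !ger0_norm; lra.
  apply: (@le_trans _ _ (lam k2 * C k2 j2 * `|c - y|)).
    by apply: gL => //; apply/andP; split; lra.
  by rewrite ler_wpM2l // !ger0_norm; lra.
- move=> u v uv H.
  apply: (@real_induction R u v (fun t => g u = g t)) => //.
    move=> t /andP[ut tv] Ht; have [|e e0 He] := gflat t.
      by apply: H; rewrite tv ltW.
    have [s /andP[h1 h2] [us ->]] := Ht _ e0.
    by apply: He; rewrite ger0_norm; lra.
  move=> t /andP[ut tv] ->; have [|e e0 He] := gflat t.
    by apply: H; rewrite ut ltW.
  have m1 : Num.min (t + e / 2) v <= t + e / 2 by rewrite ge_min lexx.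
  have tm : t < Num.min (t + e / 2) v by rewrite lt_min tv andbT; lra.
  exists (Num.min (t + e / 2) v); first by rewrite tm ge_min lexx orbT.
  by rewrite He // ltr0_norm; lra.
- move=> x nP; have nQ : ~ Q x by move=> h; apply: nP; left.
  have [e [c [k [j [k2 [j2 [e0 cx T _ [h1 h2 _ _]]]]]]]] := near_tiles x nQ.
  have xI : dy k j <= x <= dy k (j + 1) by apply/andP; split; lra.
  have S := dyS R k j.
  have dist y : K k j y -> `|x - y| <= 2 ^- k.
    by move=> /Kdy /andP[h3 h4]; rewrite ler_norml; apply/andP; split; lra.
  have fin y : K k j y -> N * 2 ^- k <= `|g x - g y| ->
      exists y, [/\ P y, N * `|x - y| <= `|g x - g y| &
         forall q, Q q -> 2 * N * `|x - y| <= eps * `|x - q|].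
    move=> Ky Hy; exists y; split.
    - by right; exists k, j.
    - by apply: le_trans Hy; rewrite ler_pM2l // dist.
    - move=> q Qq; apply: (le_trans _ (T.1 _ _ xI Qq)).
      by rewrite ler_pM2l ?mulr_gt0 // dist.
  have gK y : K k j y -> g y = lam k * beta k j y.
    by move=> /Kdy /andP[h3 h4]; apply: gT => //; rewrite !ltW.
  have [y0 K0 b0] := blow k j; have [y1 K1 b1] := bhigh k j.
  have [xl|xh] := leP (1 / 2) (beta k j x).
    apply: (fin _ K0); rewrite (gK _ K0) b0 mulr0 subr0 (gT _ _ _ T xI).
    rewrite ger0_norm; last by rewrite mulr_ge0 ?(ltW (lam0 _)) //; case/andP: (b01 k j x).
    by have := ler_wpM2l (ltW (lam0 k)) xl; rewrite /lam; lra.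
  apply: (fin _ K1); rewrite (gK _ K1) b1 (gT _ _ _ T xI) -mulrBr normrM (gtr0_norm (lam0 _)).
  rewrite ltr0_norm; last by lra.
  have : 1 / 2 <= - (beta k j x - 1) by lra.
  by move/(ler_wpM2l (ltW (lam0 k))); rewrite /lam; lra.
Qed.

Lemma whitney_closed : closed P.
Proof. exact: closedP. Qed.

Lemma whitney_sub : P `<=` F.
Proof. by move=> x [/QF //|[k [j [_ /KF]]]]. Qed.

End Whitney.

(** * Supports for the bumps, from trimness *)

Definition fat (R : realType) (F : set R) := forall a b : R, a < b ->
  exists K : set R, [/\ closed K, K `<=` F, K `<=` `]a, b[ & (0 < lebesgue_measure K)%E].

Lemma steep_layer (R : realType) (F Q : set R) (N eps : R) : fat R F ->
  closed Q -> Q `<=` F -> 0 < N -> 0 < eps ->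
  exists (g : R -> R) (P : set R), [/\ closed P, Q `<=` P & P `<=` F] /\
  [/\ forall y q, Q q -> `|g y| <= eps * `|y - q|,
      forall x, exists L d, 0 < d /\ forall y, `|x - y| < d -> `|g x - g y| <= L * `|x - y|,
      forall u v, u <= v -> (forall z, u <= z <= v -> ~ P z) -> g u = g v &
      forall x, ~ P x -> exists y, [/\ P y, N * `|x - y| <= `|g x - g y| &
         forall q, Q q -> 2 * N * `|x - y| <= eps * `|x - q|]].
Proof.
move=> fatF cQ QF N0 eps0.
have Hex (kj : nat * int) : exists t : set R * (R -> R) * R,
  let a := dy R kj.1 kj.2 in let b := dy R kj.1 (kj.2 + 1) in
  let K := t.1.1 in let beta := t.1.2 in let C := t.2 in
  [/\ closed K, K `<=` F & K `<=` `]a, b[] /\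
  ([/\ 0 <= C, forall x, 0 <= beta x <= 1,
      forall x, x <= a \/ b <= x -> beta x = 0 &
      forall x y, `|beta x - beta y| <= C * `|x - y|] /\
  [/\ forall u v, u <= v -> (forall z, u <= z <= v -> ~ K z) -> beta u = beta v,
      exists2 y, K y & beta y = 0 & exists2 y, K y & beta y = 1]).
  case: kj => k j.
  have ab : dy R k j < dy R k (j + 1) by rewrite dyS ltrDl invr_gt0 exprn_gt0.
  have [K [cK KF Kab K0]] := fatF _ _ ab.
  have [beta [C H]] := bump_exists R K _ _ ab cK Kab K0.
  by exists (K, beta, C).
have [T HT] := choice Hex.
pose K k j := (T (k, j)).1.1; pose beta k j := (T (k, j)).1.2; pose C k j := (T (k, j)).2.
have cK k j : closed (K k j) by have [[]] := HT (k, j).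
have KF k j : K k j `<=` F by have [[]] := HT (k, j).
have Kdy k j z : K k j z -> dy R k j < z < dy R k (j + 1).
  by have [[_ _ H _]] := HT (k, j) => /H; rewrite /= in_itv.
have [g Hg] := @whitney_layer R Q N eps cQ N0 eps0 K beta C cK Kdy
  (fun k j => let: conj _ (conj (And4 h _ _ _) _) := HT (k, j) in h)
  (fun k j => let: conj _ (conj (And4 _ h _ _) _) := HT (k, j) in h)
  (fun k j => let: conj _ (conj (And4 _ _ h _) _) := HT (k, j) in h)
  (fun k j => let: conj _ (conj (And4 _ _ _ h) _) := HT (k, j) in h)
  (fun k j => let: conj _ (conj _ (And3 h _ _)) := HT (k, j) in h)
  (fun k j => let: conj _ (conj _ (And3 _ h _)) := HT (k, j) in h)
  (fun k j => let: conj _ (conj _ (And3 _ _ h)) := HT (k, j) in h).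
exists g; eexists; split; last exact: Hg.
split; first exact: (@whitney_closed R Q N eps cQ N0 eps0 K cK Kdy).
  by move=> x Qx; left.
exact: (@whitney_sub R F Q N eps QF K KF).
Qed.

Lemma trim_fat (R : realType) (E : set R) : trim E -> Gdelta E -> fat R (~` E).
Proof.
move=> tE gE a b ab; have mE := Gdelta_measurable gE.
pose a' := (2 * a + b) / 3; pose b' := (a + 2 * b) / 3.
have aa' : a < a' by rewrite /a'; lra.
have bb' : b' < b by rewrite /b'; lra.
have ab' : a' < b' by rewrite /a' /b'; lra.
have := tE _ _ ab'; rewrite lebesgue_outer_ltE //.
have [G oG EG] := gE.
have mGI n : measurable (~` G n `&` `]a', b'[ : set (measurableTypeR R)).
  apply: measurableI => //; apply: measurableC; exact: measurable_realfun.open_measurable.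
have [[n Gn] _|h] := pselect (exists n, (0 < lebesgue_measure (~` G n `&` `]a', b'[))%E).
  exists (~` G n `&` `[a', b']); split.
  - by apply: closedI; [exact: open_closedC | exact: interval_closed].
  - by move=> z [nG _]; rewrite EG => /(_ n I).
  - move=> z [_ /=]; rewrite !in_itv /= => /andP[h1 h2].
    by rewrite (lt_le_trans aa') ?(le_lt_trans h2).
  - apply: lt_le_trans Gn _; apply: le_measure; rewrite ?inE //.
      apply: measurableI => //; apply: measurableC; exact: measurable_realfun.open_measurable.
    by apply: setIS; exact: subset_itv_oo_cc.
rewrite ltNge => /negP[].
have sub : ~` E `&` `]a', b'[ `<=` \bigcup_n (~` G n `&` `]a', b'[).
  move=> z [nE zI]; apply: contrapT => nz; apply: nE; rewrite EG => n _.
  by apply: contrapT => nG; apply: nz; exists n.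
apply: (le_trans (measure_sigma_subadditive _ mGI _ sub)).
  by apply: measurableI => //; exact: measurableC.
rewrite eseries0 // => n _ _; apply/eqP; rewrite -measure_le0 leNgt.
by apply/negP => Gn; apply: h; exists n.
Qed.

(** * Summing the layers *)

Lemma continuous_affine_bound (R : realType) (f : R -> R) (x : R) :
  (forall e, 0 < e -> exists L d, 0 < d /\
    forall y, `|x - y| < d -> `|f x - f y| <= e + L * `|x - y|) ->
  {for x, continuous f}.
Proof.
move=> H; apply/cvgrPdist_le => e e0.
have [|L [d [d0 Hd]]] := H (e / 2); first by rewrite divr_gt0.
have L0 : 0 < `|L| + 1 by rewrite ltr_wpDl.
exists (Num.min d (e / 2 / (`|L| + 1))) => /=.
  by rewrite lt_min d0 !divr_gt0.
move=> y /=; rewrite lt_min => /andP[xyd]; rewrite ltr_pdivlMr // => xye.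
apply: (le_trans (Hd _ xyd)).
have : L * `|x - y| <= `|L| * `|x - y| by rewrite ler_wpM2r // ler_norm.
have := normr_ge0 (x - y); lra.
Qed.

(** Take [r] to be two thirds of the distance to [Q]: strictly below it, yet comparable to it,
    without a nearest point. *)
Lemma relative_distance (R : realType) (Q : set R) (x q0 : R) : closed Q -> ~ Q x -> Q q0 ->
  exists r q, [/\ 0 < r, Q q, `|x - q| <= 2 * r & forall q', Q q' -> r < `|x - q'|].
Proof.
move=> cQ nQ Qq0; have /closed_openC := cQ; rewrite openE => /(_ _ nQ) [d /= d0 Hd].
have {}Hd q : Q q -> d <= `|x - q|.
  by move=> Qq; rewrite leNgt; apply/negP => /Hd; exact.
pose D := [set `|x - q| | q in Q].
have hD : has_inf D by split; [exists `|x - q0|, q0 | exists d => _ [q Qq <-]; exact: Hd].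
have i0 : d <= inf D by apply: lb_le_inf; [case: hD | move=> _ [q Qq <-]; exact: Hd].
have i3 : 0 < inf D / 3 by lra.
have [_ [q Qq <-] Hq] := inf_adherent i3 hD.
exists (2 * inf D / 3), q; split => //; [lra | lra |].
move=> q' Qq'; have : inf D <= `|x - q'| by apply: ge_inf; [case: hD | exists q'].
lra.
Qed.

Lemma exp2_anti (R : realType) (m n : nat) : (m <= n)%N -> 2 ^- n <= 2 ^- m :> R.
Proof. by move=> mn; rewrite lef_pV2 ?posrE ?exprn_gt0 // ler_weXn2l // ler1n. Qed.

Section Construction.
Variables (R : realType) (E : set R) (G : nat -> set R).
Hypotheses (oG : forall n, open (G n)) (EG : E = \bigcap_n G n) (fatE : fat R (~` E)).
Variables (g : nat -> R -> R) (Q P : nat -> set R).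
Variable p : R.
Hypothesis (Q0p : forall n, Q n p).
Hypothesis (cQ : forall n, closed (Q n)).
Hypothesis (QE : forall n, Q n `<=` ~` E).
Hypothesis (QP : forall n, Q n `<=` P n).
Hypothesis (PQ : forall n, P n `<=` Q n.+1).
Hypothesis (GQ : forall n, ~` G n `<=` Q n.+1).
Hypothesis (gQ : forall n y q, Q n q -> `|g n y| <= 2 ^- n.+1 * `|y - q|).
Hypothesis (gL : forall n x, exists L d, 0 < d /\
  forall y, `|x - y| < d -> `|g n x - g n y| <= L * `|x - y|).
Hypothesis (gF : forall n u v, u <= v -> (forall z, u <= z <= v -> ~ P n z) -> g n u = g n v).
Hypothesis (gS : forall n x, ~ P n x -> exists y, [/\ P n y,
  n.+2%:R * `|x - y| <= `|g n x - g n y| &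
  forall q, Q n q -> 2 * n.+2%:R * `|x - y| <= 2 ^- n.+1 * `|x - q|]).

Let S n x := series (fun i => g i x) n.
Let f x := limn (S ^~ x).

Let p2 k : 0 < 2 ^- k :> R.
Proof. by rewrite invr_gt0 exprn_gt0. Qed.

Let p21 k : 2 ^- k <= 1 :> R.
Proof. by have := exp2_anti R 0 k (leq0n _); rewrite expr0 invr1. Qed.

Let Qm m n : (m <= n)%N -> Q m `<=` Q n.
Proof.
elim: n => [|n IH]; first by rewrite leqn0 => /eqP->.
by rewrite leq_eqVlt => /orP[/eqP-> //|/IH h] z /h /QP /PQ.
Qed.

Let S1 n x : S n.+1 x = S n x + g n x.
Proof. by rewrite /S /series /= big_nat_recr. Qed.

(** A point of [Q n] lies in all later [Q i], so the bounds [gQ] add up to a geometric sum. *)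
Let Stail n m y q : Q n q -> `|S (n + m) y - S n y| <= (2 ^- n - 2 ^- (n + m)) * `|y - q|.
Proof.
move=> Qq; elim: m => [|m IH]; first by rewrite addn0 !subrr normr0 mul0r.
rewrite addnS S1 addrAC (le_trans (ler_normD _ _)) //.
have := gQ (n + m) y q (Qm _ _ (leq_addr _ _) _ Qq).
have h2 : 2 ^- (n + m) = 2 * 2 ^- (n + m).+1 :> R.
  by rewrite exprS invfM mulrA divff ?mul1r // pnatr_eq0.
move: IH; rewrite h2; lra.
Qed.

(** The common point [p] of all [Q n] gives a geometric majorant. *)
Let Scvg y : cvgn (S ^~ y).
Proof.
apply: normed_cvg.
apply: (@series_le_cvg _ _ (geometric (`|y - p| / 2) (2^-1))).
- by move=> n; exact: normr_ge0.
- by move=> n; rewrite /geometric /= mulr_ge0 ?divr_ge0 // exprn_ge0.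
- move=> n; apply: (le_trans (gQ n y p (Q0p n))).
  by rewrite /geometric /= exprS invfM exprVn mulrC mulrA.
- apply: is_cvg_geometric_series; rewrite ger0_norm // invf_lt1 //; lra.
Qed.

Let ftail n y q : Q n q -> `|f y - S n y| <= 2 ^- n * `|y - q|.
Proof.
move=> Qq; apply/ler_addgt0Pr => e e0.
have /cvgrPdist_lt /(_ _ e0) [m _ Hm] := Scvg y.
have := Hm (n + m)%N (leq_addl _ _); rewrite /= -/(f y) => h.
have := Stail n m y q Qq.
have : `|f y - S n y| <= `|f y - S (n + m) y| + `|S (n + m) y - S n y|.
  by rewrite (le_trans _ (ler_normD _ _)) // addrA subrK.
have : 0 <= 2 ^- (n + m) * `|y - q| by rewrite mulr_ge0 // ltW.
rewrite mulrBl; lra.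
Qed.

Let fQ n q : Q n q -> f q = S n q.
Proof.
move=> Qq; have := ftail n q q Qq.
by rewrite subrr normr0 mulr0 normr_le0 subr_eq0 => /eqP.
Qed.

Let SL n x : exists L d, 0 < d /\
  forall y, `|x - y| < d -> `|S n x - S n y| <= L * `|x - y|.
Proof.
elim: n => [|n [L [d [d0 H]]]].
  exists 0, 1; split => // y _.
  by rewrite /S /series /= !big_geq // subrr normr0 mul0r.
have [L' [d' [d'0 H']]] := gL n x.
exists (L + L'), (Num.min d d'); split; first by rewrite lt_min d0.
move=> y; rewrite lt_min => /andP[/H h /H' h']; rewrite !S1 opprD addrACA mulrDl.
by rewrite (le_trans (ler_normD _ _)) // lerD.
Qed.

(** The layers below [n] vary only on sets [P i] contained in [Q n]. *)
Let SF n x y : (forall z, `|x - z| <= `|x - y| -> ~ Q n z) -> S n x = S n y.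
Proof.
move=> H; suff h u v : u <= v -> (forall z, u <= z <= v -> ~ Q n z) -> S n u = S n v.
  have [xy|yx] := leP x y.
    apply: h => // z /andP[h1 h2]; apply: H.
    by rewrite !ler0_norm; lra.
  apply/esym/h => [|z /andP[h1 h2]]; first exact: ltW.
  by apply: H; rewrite !ger0_norm; lra.
move=> uv {}H; rewrite /S /series /= !big_mkord; apply: eq_bigr => i _.
apply: gF => // z zI /PQ Qz; apply: (H _ zI).
by apply: Qm Qz; exact: ltn_ord.
Qed.

Let EQ x : ~ E x -> exists n, Q n x.
Proof.
move=> nE; apply: contrapT => h; apply: nE; rewrite EG => n _.
by apply: contrapT => nG; apply: h; exists n.+1; exact: GQ.
Qed.

(** The complement of [E] is dense by fatness and is exhausted by the [Q n]. *)
Let close_Q x d : 0 < d -> exists n q, Q n q /\ `|x - q| < d.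
Proof.
move=> d0; have [|K [_ KE Kx K0]] := fatE x (x + d); first by rewrite ltrDl.
have [q Kq] : exists q, K q.
  apply: contrapT => h; move: K0; rewrite (_ : K = set0) ?measure0 ?ltxx //.
  by apply/seteqP; split => // z Kz; apply: h; exists z.
have [n Qq] := EQ _ (KE _ Kq); exists n, q; split => //.
have := Kx _ Kq; rewrite /= in_itv /= => /andP[h1 h2].
by rewrite ltr_norml; apply/andP; split; lra.
Qed.

(** A point off [E] lies in some [Q n], where [f] is the locally Lipschitz [S n] plus a tail
    controlled by the distance to that point. On [E], layer [n] gives steep chords, while [f] is
    nearly constant at scales comparable to the distance to [Q n]. *)
Lemma layered_sum : exists f : R -> R, [/\ continuous f, L_inf f = E, l_inf f = set0 &
       forall x, E x -> lip f x = 0%E].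
Proof.
have Lip_notE x : ~ E x -> exists L d, 0 < d /\
    forall y, `|x - y| < d -> `|f x - f y| <= L * `|x - y|.
  move=> /EQ[n Qx]; have [L [d [d0 H]]] := SL n x.
  exists (L + 1), d; split => // y xyd; rewrite (fQ _ _ Qx) mulrDl mul1r.
  have := H _ xyd; have := ftail n y x Qx.
  have : 2 ^- n * `|y - x| <= `|y - x| by rewrite ler_piMl.
  have : `|S n x - f y| <= `|S n x - S n y| + `|S n y - f y|.
    by rewrite (le_trans _ (ler_normD _ _)) // addrA subrK.
  rewrite (distrC (S n y)) (distrC y); lra.
have Lip_E x : E x -> Lip f x = +oo%E.
  move=> Ex; apply/Lip_ooP => N d d0.
  have nQ n : ~ Q n x by move=> /QE.
  have [n0 [q0 [Qq0 xq0]]] := close_Q x _ d0.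
  pose n := maxn n0 (Num.trunc `|N|).
  have Qq : Q n q0 by apply: Qm Qq0; exact: leq_maxl.
  have [y [Py Hy yq]] := gS n x (fun h => nQ n.+1 (PQ _ _ h)).
  have xy0 : 0 < `|x - y|.
    rewrite normr_gt0 subr_eq0; apply/eqP => xy; apply: (nQ n.+1); apply: PQ.
    by rewrite xy.
  have xyq q : Q n q -> `|x - y| < `|x - q|.
    move=> /yq; have : 2 * 2 * `|x - y| <= 2 * n.+2%:R * `|x - y|.
      by rewrite ler_pM2r // ler_pM2l // ler_nat.
    have : 2 ^- n.+1 * `|x - q| <= `|x - q| by rewrite ler_piMl.
    lra.
  exists y; first by rewrite xy0 (lt_trans (xyq _ Qq)).
  (* [y] is nearer to [x] than any point of [Q n]. *)
  have Sxy : S n x = S n y.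
    by apply: SF => z xz /xyq; rewrite ltNge xz.
  have Qy : Q n.+1 y by exact: PQ.
  have := ftail n.+1 x y Qy; rewrite (fQ _ _ Qy) !S1 Sxy => fx.
  have : `|g n x - g n y| <= `|f x - (S n y + g n x)| + `|f x - (S n y + g n y)|.
    rewrite (distrC (f x)) (le_trans _ (ler_normD _ _)) //.
    by rewrite (_ : g n x - g n y = S n y + g n x - f x + (f x - (S n y + g n y))) //; ring.
  have : 2 ^- n.+1 * `|x - y| <= `|x - y| by rewrite ler_piMl.
  (* Of the slope [n+2] of layer [n], the later layers cost at most 1. *)
  have [c E2 Nc] : exists2 c : R, n.+2%:R = c + 1 & N <= c.
    exists n.+1%:R; first by rewrite natr1.
    apply: (le_trans (ler_norm _)); apply/ltW/(lt_le_trans (Num.Theory.truncnS_gt _)).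
    by rewrite ler_nat ltnS leq_maxr.
  have : N * `|x - y| <= c * `|x - y| by rewrite ler_pM2r.
  move: Hy; rewrite E2; lra.
have lip_E x : E x -> lip f x = 0%E.
  move=> Ex; have nQ n : ~ Q n x by move=> /QE.
  apply/eqP; rewrite eq_le lip_ge0 andbT; apply/lee_addgt0Pr => e e0; rewrite add0e.
  apply: lip_le => d d0; have [n0 [q0 [Qq0 xq0]]] := close_Q x _ d0.
  (* The tails are at most [2^-n] times [2 * r] at [x] and [3 * r] at [y], hence the 5. *)
  have [|k Hk] := dy_small R (e / 5); first by rewrite divr_gt0.
  pose n := maxn n0 k.
  have ne : 2 ^- n <= e / 5 by apply: le_trans Hk; apply: exp2_anti; exact: leq_maxr.
  have Qq : Q n q0 by apply: Qm Qq0; exact: leq_maxl.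
  have [r [q [r0 Qnq xq rQ]]] := relative_distance R (Q n) x q0 (cQ n) (nQ n) Qq.
  exists r; first by rewrite r0 (lt_trans (rQ _ Qq)).
  move=> y xy; have Sxy : S n x = S n y.
    apply: SF => z xz /rQ; rewrite ltNge => /negP; apply; exact: le_trans xy.
  have := ftail n x q Qnq; have := ftail n y q Qnq; rewrite Sxy.
  have : 2 ^- n * `|x - q| <= 2 ^- n * (2 * r) by rewrite ler_pM2l.
  have : 2 ^- n * `|y - q| <= 2 ^- n * (3 * r).
    rewrite ler_pM2l //; have : `|y - q| <= `|y - x| + `|x - q|.
      by rewrite (le_trans _ (ler_normD _ _)) // addrA subrK.
    rewrite (distrC y x); lra.
  have : `|f x - f y| <= `|f x - S n y| + `|f y - S n y|.
    by rewrite (distrC (f y)) (le_trans _ (ler_normD _ _)) // addrA subrK.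
  have : 2 ^- n * r <= e / 5 * r by rewrite ler_pM2r.
  lra.
exists f; split => //.
- move=> x; apply: continuous_affine_bound => e e0.
  have M0 : 0 < 2 * `|x - p| + 1 by rewrite ltr_wpDl // mulr_ge0.
  (* The tails at [x] and [y] add up to at most [2^-n * (2 * |x - p| + |x - y|)]; the [+ 1] keeps
     the denominator positive. *)
  have [|n Hn] := dy_small R (e / (2 * `|x - p| + 1)); first by rewrite divr_gt0.
  move: Hn; rewrite ler_pdivlMr // => Hn.
  have [L [d [d0 H]]] := SL n x; exists (L + 1), d; split => // y /H HS.
  have := ftail n x p (Q0p n); have := ftail n y p (Q0p n).
  have : `|y - p| <= `|x - y| + `|x - p|.
    by rewrite (distrC x y) (le_trans _ (ler_normD _ _)) // addrA subrK.
  rewrite -(ler_pM2l (p2 n)).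
  have : 2 ^- n * `|x - y| <= `|x - y| by rewrite ler_piMl.
  have : `|f x - f y| <= `|f x - S n x| + `|S n x - S n y| + `|f y - S n y|.
    rewrite (distrC (f y)) (_ : f x - f y = (f x - S n x) + (S n x - S n y) + (S n y - f y)).
      by rewrite (le_trans (ler_normD _ _)) // lerD2r ler_normD.
    by ring.
  have := p2 n; lra.
- apply/seteqP; split=> x; last exact: Lip_E.
  move=> Lx; apply: contrapT => /Lip_notE[L [d [d0 H]]].
  exact: (Lip_lt_oo _ _ _ _ _ d0 H).
- apply/seteqP; split=> x // lx; have {}lx : lip f x = +oo%E by [].
  have [Ex|nE] := pselect (E x); first by move: lx; rewrite lip_E.
  have [L [d [d0 H]]] := Lip_notE _ nE.
  suff : (lip f x <= `|L|%:E)%E by rewrite lx leye_eq.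
  apply: lip_le => d1 d10.
  exists (Num.min d d1 / 2); first by rewrite divr_gt0 ?lt_min ?d0 //= ltr_pdivrMr //
    (@le_lt_trans _ _ d1) ?ge_min ?lexx ?orbT // ltr_pMr // ltr1n.
  move=> y xy; have xyd : `|x - y| < d.
    apply: (le_lt_trans xy); rewrite ltr_pdivrMr // (@le_lt_trans _ _ d) ?ge_min ?lexx //.
    by rewrite ltr_pMr // ltr1n.
  apply: (le_trans (H _ xyd)).
  apply: (@le_trans _ _ (`|L| * `|x - y|)); first by rewrite ler_wpM2r // ler_norm.
  by rewrite ler_wpM2l.
Qed.

End Construction.

Lemma exists_of_trim_Gdelta (R : realType) (E : set R) : trim E -> Gdelta E ->
  exists f : R -> R, [/\ continuous f, L_inf f = E, l_inf f = set0 &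
       forall x, E x -> lip f x = 0%E].
Proof.
move=> tE gE; have fatE := trim_fat _ _ tE gE; have [G oG EG] := gE.
have [p Ep] : exists p, ~ E p.
  apply: contrapT => h; have [K [_ KE _ K0]] := fatE 0 1 ltr01.
  move: K0; rewrite (_ : K = set0) ?measure0 ?ltxx //.
  by apply/seteqP; split => // z /KE nE; apply: h; exists z.
have step (nQ : nat * set R) : exists gP : (R -> R) * set R,
    closed nQ.2 -> nQ.2 `<=` ~` E ->
    let n := nQ.1 in let Q := nQ.2 in let g := gP.1 in let P := gP.2 in
    [/\ closed P, Q `<=` P & P `<=` ~` E] /\
    [/\ forall y q, Q q -> `|g y| <= 2 ^- n.+1 * `|y - q|,
      forall x, exists L d, 0 < d /\ forall y, `|x - y| < d -> `|g x - g y| <= L * `|x - y|,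
      forall u v, u <= v -> (forall z, u <= z <= v -> ~ P z) -> g u = g v &
      forall x, ~ P x -> exists y, [/\ P y, n.+2%:R * `|x - y| <= `|g x - g y| &
         forall q, Q q -> 2 * n.+2%:R * `|x - y| <= 2 ^- n.+1 * `|x - q|]].
  case: nQ => n Q /=; have [[cQ QE]|h] := pselect (closed Q /\ Q `<=` ~` E).
    have e0 : 0 < 2 ^- n.+1 :> R by rewrite invr_gt0 exprn_gt0.
    have [g [P H]] := steep_layer _ _ _ _ _ fatE cQ QE (ltr0Sn _ n.+1) e0.
    by exists (g, P).
  (* A dummy layer for inadmissible [Q]; [Qok] shows that the recursion never meets one. *)
  by exists (fun=> 0, set0) => cQ QE; case: h.
have [F HF] := choice step.
pose Q := fix Q n := if n is m.+1 then (F (m, Q m)).2 `|` ~` G m else [set p].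
have Qok n : closed (Q n) /\ Q n `<=` ~` E.
  elim: n => [|n [cQ QE]]; first by split; [exact: closed_eq | move=> _ ->].
  have [[cP _ PE] _] := HF (n, Q n) cQ QE; split.
    by apply: closedU => //; exact: open_closedC.
  by move=> z [/PE //|nG]; rewrite EG => /(_ n I).
have H n := HF (n, Q n) (Qok n).1 (Qok n).2.
apply: (@layered_sum R E G EG fatE (fun n => (F (n, Q n)).1) Q
  (fun n => (F (n, Q n)).2) p) => n.
- elim: n => [//|n IH]; left; have [[_ h _] _] := H n; exact: h.
- exact: (Qok n).1.
- exact: (Qok n).2.
- by have [[]] := H n.
- by move=> z; left.
- by move=> z; right.
- by have [_ []] := H n.
- by have [_ []] := H n.
- by have [_ []] := H n.
- by have [_ []] := H n.
Qed.

Theorem theorem1 (R : realType) :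
  (forall f : R -> R, continuous f -> l_inf f = set0 ->
     trim (L_inf f) /\ Gdelta (L_inf f)) /\
  (forall E : set R, trim E -> Gdelta E ->
     exists f : R -> R, [/\ continuous f, L_inf f = E, l_inf f = set0 &
       forall x, E x -> lip f x = 0%E]).
Proof.
split=> [f cf lf|E]; last exact: exists_of_trim_Gdelta.
by split; [exact: trim_L_inf | exact: Gdelta_L_inf].
Qed.
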